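(* Let $G$ be a connected graph of order $n$, let $\tau>0$ be a real number such that $\frac{1}{\tau}\geq 2$ is an integer, let $\alpha\in\big[\frac{1}{2},\frac{3+\tau}{4+2\tau}\big)$, and suppose $$n\geq\max\Big\{2\tau^2+5\tau+\frac{2}{\tau}+8,\ \frac{(5-6\alpha)\tau^2+(13-14\alpha)\tau+4(1-\alpha)}{(1-2\alpha)\tau^2+(3-4\alpha)\tau}\Big\}.$$ If $\rho_{\alpha}(G)\geq\rho_{\alpha}\big(K_{1}\vee(K_{n-\frac{1}{\tau}-2}\cup(\frac{1}{\tau}+1)K_{1})\big)$, then $G$ is $\tau$-tough, unless $G\cong K_{1}\vee(K_{n-\frac{1}{\tau}-2}\cup(\frac{1}{\tau}+1)K_{1})$.
   Context: For a graph $G$, $A(G)$ is its adjacency matrix and $D(G)$ the diagonal matrix of vertex degrees. For $\alpha\in[0,1]$, $A_{\alpha}(G)=\alpha D(G)+(1-\alpha)A(G)$, and $\rho_{\alpha}(G)$ denotes the largest eigenvalue of $A_{\alpha}(G)$. $c(H)$ denotes the number of connected components of $H$. For a real $\tau>0$, a graph $G$ is $\tau$-tough if $|S|\geq\tau\,(c(G-S)-1)$ for every proper subset $S\subsetneq V(G)$ with $c(G-S)>1$ (a complete graph has no such $S$). $K_m$ is the complete graph on $m$ vertices, $kK_1$ is the edgeless graph on $k$ vertices, $\cup$ is disjoint union, and $G_1\vee G_2$ (join) is obtained from $G_1\cup G_2$ by adding all edges between $V(G_1)$ and $V(G_2)$. *)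

(* Defs.v *)
From HB Require Import structures.
From mathcomp Require Import all_boot all_order all_algebra.
From mathcomp Require Import boolp classical_sets reals.
Set Implicit Arguments. Unset Strict Implicit. Unset Printing Implicit Defensive.
Import Order.TTheory GRing.Theory Num.Theory.
Local Open Scope ring_scope.
Local Open Scope classical_set_scope.

Definition simple_graph (n : nat) (e : rel 'I_n) : Prop :=
  (forall x y, e x y = e y x) /\ (forall x, ~~ e x x).

Definition deg (n : nat) (e : rel 'I_n) (x : 'I_n) : nat := #|[set y | e x y]|.

Definition adjmx (R : realType) (n : nat) (e : rel 'I_n) : 'M[R]_n :=
  \matrix_(i, j) (e i j)%:R.

Definition degmx (R : realType) (n : nat) (e : rel 'I_n) : 'M[R]_n :=
  \matrix_(i, j) (if i == j then (deg e i)%:R else 0).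

Definition Aalpha (R : realType) (n : nat) (alpha : R) (e : rel 'I_n) : 'M[R]_n :=
  alpha *: degmx R e + (1 - alpha) *: adjmx R e.

(* largest eigenvalue (the eigenvalue set of a real symmetric matrix is finite
   and nonempty, so its supremum is its maximum) *)
Definition rho_alpha (R : realType) (n : nat) (alpha : R) (e : rel 'I_n) : R :=
  sup [set a : R | eigenvalue (Aalpha alpha e) a].

Definition connected_graph (n : nat) (e : rel 'I_n) : Prop :=
  forall x y, connect e x y.

Definition del_rel (n : nat) (e : rel 'I_n) (S : {set 'I_n}) : rel 'I_n :=
  fun x y => [&& x \notin S, y \notin S & e x y].

Definition ncomp_del (n : nat) (e : rel 'I_n) (S : {set 'I_n}) : nat :=
  n_comp (del_rel e S) (~: S).

Definition tough (R : realType) (n : nat) (tau : R) (e : rel 'I_n) : Prop :=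
  forall S : {set 'I_n}, S != [set: 'I_n]%SET -> (1 < ncomp_del e S)%N ->
    tau * ((ncomp_del e S).-1)%:R <= (#|S|)%:R.

Definition isomorphic (n : nat) (e1 e2 : rel 'I_n) : Prop :=
  exists f : 'I_n -> 'I_n, bijective f /\ forall x y, e1 x y = e2 (f x) (f y).

(* K_1 \/ (K_{n-k-2} \cup (k+1) K_1): vertex 0 is the dominating vertex,
   vertices 1 .. n-k-2 form the clique K_{n-k-2}, and the remaining k+1
   vertices n-k-1 .. n-1 are adjacent only to vertex 0. *)
Definition extremal_graph (n k : nat) : rel 'I_n :=
  fun x y => (x != y) &&
    [|| (val x == 0)%N, (val y == 0)%N | (val x <= n - k - 2)%N && (val y <= n - k - 2)%N].
Arguments extremal_graph : clear implicits.

(* Main.v *)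
Require Import Defs.
From HB Require Import structures.
From mathcomp Require Import all_boot all_order all_algebra.
From mathcomp Require Import boolp classical_sets reals.
From mathcomp Require Import zify ring lra.
From mathcomp Require polyrcf.
Import Order.TTheory GRing.Theory Num.Theory.
Local Open Scope ring_scope.

(** If [e] is not tough, some nonempty [S] with [s] vertices leaves at least
    [c = k s + 2] components.  Put [C = l + 1 - alpha s], and let [y] be [1] on
    [S] and [(1 - alpha) s / (C - t)] on a component of order [t]: off [S], the
    vector [y] satisfies [A y <= l y], so a symmetric Perron-Frobenius argument
    bounds all eigenvalues by [l] once the inequality also holds on [S].  There
    it involves the sum of [t / (C - t)] over the components, which by convexity
    is largest for one component of order [m = n - s - c + 1] and [c - 1]
    isolated vertices.  For [s >= 2] the choice [l = n - k - 2] works, and this is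
    below the spectral radius of the extremal graph.  For [s = 1] one takes for
    [l] the root of the quotient equation of the extremal graph, which is an
    eigenvalue of it; equality everywhere forces [e] to be that graph. *)

(** * Spectral bounds from a positive test vector *)

(** Strictness survives the supremum because the characteristic polynomial is nonzero at [l], hence
    by continuity on a whole neighbourhood of [l]. *)
Lemma sup_eigenvalue_lt (R : realType) (n : nat) (A : 'M[R]_n) (l : R) :
  0 < l -> (forall a, eigenvalue A a -> a < l) ->
  sup [set a : R | eigenvalue A a]%classic < l.
Proof.
move=> l0 Al.
have [E0|nE] := pselect ([set a : R | eigenvalue A a]%classic !=set0)%classic; last first.
  (* The supremum of the empty set is [0] by convention, so this case rests on [0 < l]. *)
  by rewrite sup_out// => - [].
have pl : (char_poly A).[l] != 0.
  by apply/negP => pl; have := Al l; rewrite eigenvalue_root_char ltxx => /(_ pl).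
have e0 : 0 < `|(char_poly A).[l]| by rewrite normr_gt0.
have [d d0 hd] := polyrcf.poly_cont l (char_poly A) e0.
apply: (@le_lt_trans _ _ (l - d)); last by rewrite ltrBlDr ltrDl.
apply: ge_sup => // a /= Aa; rewrite leNgt; apply/negP => lda.
have al := Al _ Aa; rewrite eigenvalue_root_char in Aa.
have := hd a; rewrite (rootP Aa) sub0r normrN ltxx => H.
by apply/notF/H; rewrite ltr0_norm; lra.
Qed.

Section PositiveTestVector.
Variables (R : realFieldType) (n : nat) (A : 'M[R]_n) (y : 'I_n -> R) (l : R).
Hypothesis A0 : forall i j, 0 <= A i j.
Hypothesis y0 : forall i, 0 < y i.
Hypothesis Ay : forall j, \sum_i y i * A i j <= l * y j.

Lemma test_vector_max (v : 'rV[R]_n) : v != 0 ->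
  exists i M, [/\ 0 < M, `|v 0 i| = M * y i & forall j, `|v 0 j| <= M * y j].
Proof.
move=> v0.
have [i0 vi0] : exists i, v 0 i != 0.
  by apply/existsP; apply: contraNT v0 => /existsPn v0; apply/eqP/rowP => i;
     rewrite mxE; apply/eqP; have := v0 i; rewrite negbK.
pose i := [arg max_(i > i0) (`|v 0 i| / y i)]%O.
have imax j : `|v 0 j| / y j <= `|v 0 i| / y i.
  by rewrite /i; case: arg_maxP => // m _ /(_ j isT).
exists i, (`|v 0 i| / y i); split.
- by apply: lt_le_trans (imax i0); rewrite divr_gt0// normr_gt0.
- by rewrite divfK// gt_eqF.
- by move=> j; rewrite -ler_pdivrMr.
Qed.

(** With [M] the maximal ratio [|v_j| / y_j], attained at [i], one has [a M y_i <= sum |v_j| A_ji <=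
    M sum y_j A_ji <= l M y_i]. If [l <= a], all of these are equalities, and every [j] with
    [A j i > 0] attains the ratio as well. *)
Lemma test_vector_step (v : 'rV[R]_n) (a M : R) (i : 'I_n) :
  v *m A = a *: v -> 0 < M -> `|v 0 i| = M * y i ->
  (forall j, `|v 0 j| <= M * y j) ->
  a <= l /\ (l <= a -> \sum_j y j * A j i = l * y i /\
                       forall j, 0 < A j i -> `|v 0 j| = M * y j).
Proof.
move=> vA M0 vi vM.
have E : a * v 0 i = \sum_j v 0 j * A j i.
  by have /rowP/(_ i) := vA; rewrite !mxE => <-.
have le1 : a * (M * y i) <= \sum_j `|v 0 j| * A j i.
  rewrite -vi (le_trans (ler_norm _))// normrM normr_id -normrM E.
  rewrite (le_trans (ler_norm_sum _ _ _))// ler_sum// => j _.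
  by rewrite normrM (ger0_norm (A0 _ _)).
have le2 j : `|v 0 j| * A j i <= M * (y j * A j i).
  by rewrite mulrA ler_wpM2r.
have le3 : \sum_j `|v 0 j| * A j i <= \sum_j M * (y j * A j i).
  by apply: ler_sum => j _.
have le4 : \sum_j M * (y j * A j i) <= l * (M * y i).
  by rewrite -mulr_sumr mulrCA ler_pM2l.
have My : 0 < M * y i by rewrite mulr_gt0.
split; first by rewrite -(ler_pM2r My); lra.
move=> la; have la' : l * (M * y i) <= a * (M * y i) by rewrite ler_pM2r.
split.
  have Mn : M != 0 by rewrite gt_eqF.
  apply: (mulfI Mn); rewrite mulr_sumr; apply/eqP; rewrite eq_le [M * (l * _)]mulrCA le4/=; lra.
move=> j Aji.
have S0 : \sum_j (M * (y j * A j i) - `|v 0 j| * A j i) = 0.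
  by rewrite sumrB; apply/eqP; rewrite eq_le; apply/andP; split; lra.
have /eqP := S0; rewrite psumr_eq0; last by move=> m _; rewrite subr_ge0.
move=> /allP/(_ j (mem_index_enum _)); rewrite /= subr_eq0 mulrA => /eqP H.
by apply/esym/(mulIf _ H); rewrite gt_eqF.
Qed.

Lemma eigenvalue_le_test a : eigenvalue A a -> a <= l.
Proof.
case/eigenvalueP => v vA /test_vector_max [i [M [M0 vi vM]]].
by have [] := test_vector_step _ _ _ _ vA M0 vi vM.
Qed.

(** The maximal ratio spreads from one index along positive entries, so by connectivity it is
    attained everywhere and the test inequality is tight everywhere. *)
Lemma eigenvalue_eq_test a : (forall i j, connect (fun i j => 0 < A j i) i j) ->
  eigenvalue A a -> l <= a -> forall j, \sum_i y i * A i j = l * y j.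
Proof.
move=> conn /eigenvalueP [v vA /test_vector_max [i [M [M0 vi vM]]]] la j.
have step m := fun vm => proj2 (test_vector_step _ _ _ m vA M0 vm vM) la.
suff vj : `|v 0 j| = M * y j by have [] := step j vj.
have /connectP[p] := conn i j.
elim: p i vi => [|m p IHp] i vi /=; first by move=> _ ->.
by case/andP => Ami pth lst; apply: IHp pth lst; have [_ ->] := step i vi.
Qed.

End PositiveTestVector.

(** The constant vector [1] serves as test vector, the sum of all entries being at least each column
    sum. Boundedness is what lets [sup] dominate every eigenvalue. *)
Lemma has_ubound_eigenvalue (R : realType) (n : nat) (A : 'M[R]_n) :
  (forall i j, 0 <= A i j) -> has_ubound [set a : R | eigenvalue A a]%classic.
Proof.
move=> A0; exists (\sum_j \sum_i A i j) => a /=.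
apply: (eigenvalue_le_test _ _ _ (fun=> 1)) => // j.
rewrite mulr1 [X in _ <= X](bigD1 j) //=.
under eq_bigr do rewrite mul1r.
by rewrite lerDl; apply: sumr_ge0 => i _; apply: sumr_ge0 => i' _.
Qed.

(** * Components of a vertex-deleted graph *)

(** A component of order [t] contributes [t] terms equal to [1 / t]. This turns sums over components
    into sums over vertices. *)
Lemma sum_inv_card_component (R : numFieldType) (T : finType) (d : rel T) (a : {set T}) :
  connect_sym d -> closed d a ->
  \sum_(v in a) (#|connect d v|%:R : R)^-1 = (n_comp d a)%:R.
Proof.
move=> cd ca.
rewrite (partition_big (fingraph.root d) (fun r => fingraph.roots d r && (r \in a))) /=; last first.
  move=> v va; rewrite roots_root//= -(closed_connect ca (connect_root d v)).
  exact: va.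
rewrite (eq_bigr (fun=> 1)); last first.
  move=> r /andP[/eqP rr ra].
  rewrite (eq_big (fun v => v \in connect d r) (fun=> (#|connect d r|%:R)^-1)).
  - rewrite sumr_const -[X in X = _]mulr_natl mulfV// pnatr_eq0 -lt0n.
    by apply/card_gt0P; exists r; exact: connect0.
  - move=> v; rewrite -[X in _ == X]rr root_connect// cd inE /=.
    apply/andP/idP => [[]//|rv]; split => //.
    by rewrite -(closed_connect ca rv).
  - move=> v; rewrite -[X in _ == X]rr root_connect// cd => /andP[_ rv].
    by congr (_%:R^-1); apply: eq_card => w; rewrite !inE (same_connect cd rv).
by rewrite sumr_const; congr (_%:R); apply: eq_card => r; rewrite !inE.
Qed.

(** The set [B] takes one root from each component other than that of [v]; it is disjoint from the
    component of [v], and both lie in [a]. *)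
Lemma card_component_le (T : finType) (d : rel T) (a : {set T}) (v : T) :
  connect_sym d -> closed d a -> v \in a ->
  (#|connect d v| + n_comp d a <= #|a|.+1)%N.
Proof.
move=> cd ca va.
pose B := [predD1 [predI fingraph.roots d & a] & fingraph.root d v].
have -> : n_comp d a = #|B|.+1.
  rewrite /n_comp_mem (cardD1 (fingraph.root d v)) !inE roots_root//.
  by rewrite -(closed_connect ca (connect_root d v)) va.
rewrite addnS ltnS -cardUI.
have -> : #|[predI connect d v & B]| = 0%N.
  apply: eq_card0 => w; rewrite !inE; apply/negP => /andP[vw /and3P[/eqP nw /eqP rw _]].
  by apply: nw; rewrite -rw; apply/esym/(fingraph.rootP cd).
rewrite addn0; apply: subset_leq_card; apply/fintype.subsetP => w.
rewrite !inE => /orP[vw|/and3P[_ _ //]].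
by rewrite -(closed_connect ca vw).
Qed.

Section Deletion.
Variables (n : nat) (e : rel 'I_n) (S : {set 'I_n}).
Hypothesis esym : forall x y, e x y = e y x.

Lemma del_rel_connect_sym : connect_sym (del_rel e S).
Proof.
by apply: sym_connect_sym => x y; rewrite /del_rel esym andbCA.
Qed.

Lemma del_rel_closed : closed (del_rel e S) (~: S).
Proof. by move=> x y /and3P[xS yS _]; rewrite !inE xS yS. Qed.

End Deletion.

Lemma connected_cut_gt0 (n : nat) (e : rel 'I_n) (S : {set 'I_n}) :
  connected_graph e -> (1 < ncomp_del e S)%N -> (0 < #|S|)%N.
Proof.
move=> conn c1; rewrite lt0n; apply/negP => /eqP/cards0_eq S0.
have n0 : (0 < n)%N.
  by rewrite -[X in (_ < X)%N]card_ord (leq_trans (ltnW c1))// max_card.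
pose r := Ordinal n0.
have dE : connect (del_rel e S) =2 connect e.
  by apply: eq_connect => x y; rewrite /del_rel S0 !inE.
have cd : connect_sym (del_rel e S) by move=> x y; rewrite !dE !conn.
have H := n_comp_connect cd r.
move: c1; rewrite /ncomp_del (eq_n_comp_r (a' := connect (del_rel e S) r)) ?H//.
by move=> x; rewrite [RHS](dE r x) conn S0 !inE.
Qed.

(** * Eigenvalues of a graph with a vertex cut *)

Lemma card_deg (n : nat) (e : rel 'I_n) (x : 'I_n) : deg e x = #|[pred y | e x y]|.
Proof. by apply: eq_card => y; apply/idP/idP; rewrite !inE. Qed.

(** Eigenvectors are row vectors here, so the product with the matrix is computed by columns. *)
Lemma Aalpha_col (R : realType) (n : nat) (e : rel 'I_n) (alpha : R)
  (y : 'I_n -> R) (j : 'I_n) :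
  \sum_i y i * Aalpha alpha e i j =
  alpha * (deg e j)%:R * y j + (1 - alpha) * \sum_(i | e i j) y i.
Proof.
rewrite (eq_bigr (fun i => (if i == j then alpha * (deg e i)%:R * y i else 0)
   + (1 - alpha) * (if e i j then y i else 0))).
  by rewrite big_split /= -big_mkcond big_pred1_eq -mulr_sumr -big_mkcond.
move=> i _; rewrite !mxE; case: eqP => _; case: (e i j) => /=; ring.
Qed.

Lemma Aalpha_ge0 (R : realType) (n : nat) (e : rel 'I_n) (alpha : R) (i j : 'I_n) :
  0 <= alpha <= 1 -> 0 <= Aalpha alpha e i j.
Proof.
move=> /andP[a0 a1]; rewrite !mxE addr_ge0// mulr_ge0// ?subr_ge0//.
by case: ifP.
Qed.

Lemma Aalpha_gt0 (R : realType) (n : nat) (e : rel 'I_n) (alpha : R) (i j : 'I_n) :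
  0 <= alpha < 1 -> e i j -> 0 < Aalpha alpha e i j.
Proof.
move=> /andP[a0 a1] eij; rewrite !mxE eij ltr_wpDl ?mulr_gt0 ?subr_gt0//.
by rewrite mulr_ge0//; case: ifP.
Qed.

Section VertexCut.
Variables (R : realType) (n : nat) (e : rel 'I_n) (alpha l : R) (S : {set 'I_n}).
Variables (c m : nat).
Hypothesis e_simple : simple_graph e.
Hypothesis alpha01 : 0 <= alpha < 1.
Hypothesis S0 : (0 < #|S|)%N.
Hypothesis c2 : (1 < c)%N.
Hypothesis cS : (c <= ncomp_del e S)%N.
Hypothesis mcS : (m + c + #|S| = n.+1)%N.

Let s : R := #|S|%:R.
Let C : R := l + 1 - alpha * s.
Hypothesis mC : m%:R < C.

Let d := del_rel e S.
Let t v : nat := #|connect d v|.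
(** The value off [S] solves [(C - t) y = (1 - alpha) s], which is [A y = l y] at a vertex adjacent
    to all of [S] and to all the rest of its component. *)
Let y v : R := if v \in S then 1 else (1 - alpha) * s / (C - (t v)%:R).

Let e_sym : forall x y, e x y = e y x := proj1 e_simple.
Let cd : connect_sym d := @del_rel_connect_sym n e S e_sym.
Let clS : closed d (~: S) := @del_rel_closed n e S.

Let s0 : 0 < s. Proof. by rewrite ltr0n. Qed.
Let b0 : 0 < 1 - alpha. Proof. by rewrite subr_gt0; case/andP: alpha01. Qed.
Let a0 : 0 <= alpha. Proof. by case/andP: alpha01. Qed.

Lemma cut_card : (#|S| + #|~: S| = n)%N.
Proof. by rewrite cardsC card_ord. Qed.

Lemma cut_comp_gt0 v : (0 < t v)%N.
Proof. by apply/card_gt0P; exists v; exact: connect0. Qed.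

Lemma cut_comp_le v : v \notin S -> (t v <= m)%N.
Proof.
move=> vS; have := @card_component_le _ d (~: S) v cd clS.
rewrite inE vS => /(_ isT); rewrite -/(t v) => H.
have N := cut_card; have c' : (c <= n_comp d (~: S))%N := cS.
rewrite -(leq_add2r (n_comp d (~: S))) (leq_trans H)//.
rewrite (leq_trans _ (leq_add (leqnn m) c'))//.
by rewrite -(leq_add2r #|S|) mcS addSn addnC N.
Qed.

Lemma cut_comp_lt v : v \notin S -> 0 < C - (t v)%:R.
Proof.
by move=> vS; rewrite subr_gt0 (le_lt_trans _ mC)// ler_nat cut_comp_le.
Qed.

Lemma cut_test_gt0 v : 0 < y v.
Proof.
rewrite /y; case: ifPn => // vS.
by rewrite divr_gt0 ?mulr_gt0// cut_comp_lt.
Qed.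

(** This is the sum of [t / (C - t)] over [c - 1] components of order [1] and one of order [m]. *)
Let mu := (c%:R - 1) / (C - 1) + m%:R / (C - m%:R).

(* The slope [K] is that of the chord of [t |-> t / (C - t)] between [1] and
   [m]; this function is convex. *)
Lemma cut_sum :
  let f := \sum_(v in ~: S) (C - (t v)%:R)^-1 in
  f <= mu /\ (f = mu -> ncomp_del e S = c /\
              forall v, v \notin S -> t v = 1%N \/ t v = m).
Proof.
move=> f.
pose K := C / ((C - m%:R) * (C - 1)).
(* The chord value at [t] divided by [t], so that each of the [t] vertices of a component carries an
   equal share. *)
pose h v : R := (t v)%:R^-1 / (C - 1) + (1 - (t v)%:R^-1) * K.
have [v0 v0S] : exists v, v \notin S.
  have : (0 < #|~: S|)%N by have := cut_card; move: (mcS) c2 cS;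
    have := max_card (mem S); rewrite card_ord; lia.
  by case/card_gt0P => v; rewrite inE => ?; exists v.
have m1 : 1 <= m%:R :> R.
  by rewrite ler1n (leq_trans (cut_comp_gt0 v0) (cut_comp_le _ v0S)).
have C1 : 0 < C - 1 by rewrite subr_gt0; apply: le_lt_trans mC.
have Cm : 0 < C - m%:R by rewrite subr_gt0.
have C0 : 0 < C by lra.
(* The factors [t - 1] and [m - t] show the sign of the gap and that it vanishes only at the two
   ends of the chord. *)
have hE v : v \notin S -> h v - (C - (t v)%:R)^-1 =
    ((t v)%:R - 1) * (m%:R - (t v)%:R) * (C / ((t v)%:R * (C - 1) * (C - m%:R) * (C - (t v)%:R))).
  move=> vS; rewrite /h /K; field.
  by rewrite !gt_eqF ?cut_comp_lt// ltr0n cut_comp_gt0.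
have h_ge v : v \notin S -> 0 <= h v - (C - (t v)%:R)^-1.
  move=> vS; rewrite hE//.
  have t0 : 0 < (t v)%:R :> R by rewrite ltr0n cut_comp_gt0.
  have Ct := cut_comp_lt _ vS.
  apply: mulr_ge0; last by rewrite divr_ge0 ?(ltW C0)// ltW// !mulr_gt0.
  by rewrite mulr_ge0// subr_ge0 ?ler1n ?cut_comp_gt0 ?ler_nat ?cut_comp_le.
have sumh : \sum_(v in ~: S) h v =
    (ncomp_del e S)%:R / (C - 1) + (#|~: S|%:R - (ncomp_del e S)%:R) * K.
  rewrite big_split /= -!mulr_suml sumrB sumr_const.
  by rewrite (sum_inv_card_component _ _ _ _ cd clS).
have mE : m%:R = #|~: S|%:R + 1 - c%:R :> R.
  have : (m + c = #|~: S| + 1)%N by have := cut_card; move: mcS; lia.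
  by move=> /(congr1 (fun x => x%:R : R)); rewrite !natrD; lra.
(* Each component beyond [c] lowers the chord sum by [K - 1 / (C - 1) = m / ((C - m) (C - 1))];
   equality therefore forces exactly [c] components. *)
have muE : mu - \sum_(v in ~: S) h v =
    ((ncomp_del e S)%:R - c%:R) * (m%:R / ((C - m%:R) * (C - 1))).
  rewrite sumh /mu /K.
  have -> : #|~: S|%:R = m%:R - 1 + c%:R :> R by rewrite mE; ring.
  by field; rewrite !gt_eqF.
have mK : 0 < m%:R / ((C - m%:R) * (C - 1)).
  by rewrite divr_gt0 ?mulr_gt0//; lra.
have muh : 0 <= mu - \sum_(v in ~: S) h v.
  by rewrite muE mulr_ge0 ?(ltW mK)// subr_ge0 ler_nat.
have fh : f <= \sum_(v in ~: S) h v.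
  by apply: ler_sum => v; rewrite inE => vS; rewrite -subr_ge0 h_ge.
split; first by lra.
move=> fmu; split.
  apply/eqP; rewrite -(eqr_nat R) -subr_eq0.
  have : ((ncomp_del e S)%:R - c%:R) * (m%:R / ((C - m%:R) * (C - 1))) = 0.
    by rewrite -muE; lra.
  by move/eqP; rewrite mulf_eq0 (gt_eqF mK) orbF.
have /eqP : \sum_(v in ~: S) (h v - (C - (t v)%:R)^-1) = 0.
  by rewrite sumrB -/f; lra.
rewrite psumr_eq0; last by move=> v; rewrite inE; exact: h_ge.
move=> /allP Z v vS; have := Z v (mem_index_enum _).
rewrite inE vS /= hE// mulf_eq0 mulf_eq0 !subr_eq0.
rewrite [X in _ || X]gt_eqF ?orbF; last first.
  by rewrite divr_gt0// !mulr_gt0// ?cut_comp_lt// ltr0n cut_comp_gt0.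
by rewrite -[1]/(1%:R) !eqr_nat => /orP[/eqP->|/eqP->]; [left|right].
Qed.

Let col j := \sum_i y i * Aalpha alpha e i j.

(** The worst case is a vertex [j] adjacent to all other vertices. *)
Lemma cut_col_in j : j \in S ->
  col j <= alpha * (n%:R - 1) + (1 - alpha) * (s - 1)
    + (1 - alpha) ^+ 2 * s * \sum_(v in ~: S) (C - (t v)%:R)^-1.
Proof.
move=> jS; rewrite /col Aalpha_col {1}/y jS mulr1.
have en x : e x x = false by apply/negbTE; exact: (proj2 e_simple).
have dj : (deg e j)%:R <= n%:R - 1 :> R.
  rewrite card_deg lerBrDr natr1 ler_nat -[X in (_ <= X)%N]card_ord.
  rewrite [X in (_ <= X)%N](cardD1 j) add1n ltnS.
  apply: subset_leq_card; apply/fintype.subsetP => x; rewrite !inE.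
  by case: eqP => // ->; rewrite en.
have Sj : \sum_(i | e i j) y i <=
    (s - 1) + (1 - alpha) * s * \sum_(v in ~: S) (C - (t v)%:R)^-1.
  have -> : (1 - alpha) * s * \sum_(v in ~: S) (C - (t v)%:R)^-1 = \sum_(v in ~: S) y v.
    by rewrite mulr_sumr; apply: eq_bigr => v; rewrite inE /y => /negbTE ->.
  have -> : s - 1 = \sum_(v in S :\ j) y v.
    rewrite (eq_bigr (fun=> 1)); last by move=> v; rewrite !inE /y => /andP[_ ->].
    by rewrite sumr_const /s (cardsD1 j S) jS add1n -natr1 addrK.
  rewrite -bigU /=; last first.
    by rewrite -setI_eq0; apply/eqP/setP => x; rewrite !inE; case: (x \in S); rewrite ?andbF.
  rewrite big_mkcond [X in _ <= X]big_mkcond; apply: ler_sum => i _.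
  case: ifP => eij; last by case: ifP => // _; exact/ltW/cut_test_gt0.
  rewrite !inE; case: eqP eij => [->|_ _]; first by rewrite en.
  by rewrite /= orbN.
have -> : (1 - alpha) ^+ 2 * s * \sum_(v in ~: S) (C - (t v)%:R)^-1 =
  (1 - alpha) * ((1 - alpha) * s * \sum_(v in ~: S) (C - (t v)%:R)^-1) by ring.
have := ler_wpM2l a0 dj; have := ler_wpM2l (ltW b0) Sj; rewrite mulrDr; lra.
Qed.

(** The defect [l y_j - col j] is a sum of three nonnegative terms: two count the non-neighbours of
    [j] in [S] (one from the adjacency part, one from the degree part), the third the non-neighbours
    in its own component. Equality kills all of them. *)
Lemma cut_col_out j : j \notin S ->
  col j <= l * y j /\
  (col j = l * y j -> (forall i, i \in S -> e i j) /\
                      (forall i, connect d j i -> i != j -> e i j)).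
Proof.
move=> jS.
have en x : e x x = false by apply/negbTE; exact: (proj2 e_simple).
pose P := [set i in S | e i j]; pose Q := [set i in ~: S | e i j].
have degE : deg e j = (#|P| + #|Q|)%N.
  rewrite card_deg -(cardID S [pred y | e j y]); congr addn; apply: eq_card => i; rewrite !inE e_sym //.
  exact: andbC.
have Qd i : i \in Q -> connect d j i.
  by rewrite !inE => /andP[iS eij]; apply: connect1; rewrite /d /del_rel jS iS e_sym.
have sumE : \sum_(i | e i j) y i = #|P|%:R + #|Q|%:R * y j.
  rewrite (bigID (mem S)) /=; congr (_ + _).
    rewrite (eq_big (fun i => i \in P) (fun=> 1)); first by rewrite sumr_const.
    - by move=> i; rewrite !inE andbC.
    - by move=> i /andP[_ iS]; rewrite /y iS.
  rewrite (eq_big (fun i => i \in Q) (fun=> y j)); first by rewrite sumr_const mulr_natl.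
  - by move=> i; rewrite !inE andbC.
  - move=> i /andP[eij iS]; rewrite /y (negbTE iS) (negbTE jS); congr (_ / (_ - _%:R)).
    apply: eq_card => w; rewrite !inE; symmetry; apply: same_connect => //.
    by apply: Qd; rewrite !inE iS.
have PS : P \subset S by apply/fintype.subsetP => i; rewrite inE => /andP[].
have QT : j |: Q \subset [set i | connect d j i].
  apply/fintype.subsetP => i; rewrite in_setU1 => ijQ; rewrite inE; case/orP: ijQ => [/eqP->|]; last exact: Qd.
  exact: connect0.
have cQ : #|j |: Q| = #|Q|.+1 by rewrite cardsU1 !inE en andbF.
have tE : #|[set i | connect d j i]| = t j by apply: eq_card => i; rewrite !inE.
have p1 : 0 <= s - #|P|%:R by rewrite subr_ge0 ler_nat subset_leq_card.
have q1 : 0 <= (t j)%:R - 1 - #|Q|%:R :> R.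
  by rewrite subr_ge0 lerBrDr natr1 ler_nat -cQ -tE subset_leq_card.
have yj := cut_test_gt0 j.
have Cy : (C - (t j)%:R) * y j = (1 - alpha) * s.
  by rewrite /y (negbTE jS) mulrC divfK// gt_eqF// cut_comp_lt.
have E : l * y j - col j = (1 - alpha) * (s - #|P|%:R) + alpha * (s - #|P|%:R) * y j
    + ((t j)%:R - 1 - #|Q|%:R) * y j.
  rewrite /col Aalpha_col sumE degE natrD.
  have -> : l * y j = (1 - alpha) * s + ((t j)%:R - 1 + alpha * s) * y j.
    by rewrite -Cy /C; ring.
  ring.
have t1 := mulr_ge0 (ltW b0) p1.
have t2 := mulr_ge0 (mulr_ge0 a0 p1) (ltW yj).
have t3 := mulr_ge0 q1 (ltW yj).
split; first by lra.
move=> eqc.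
have z1 : s - #|P|%:R = 0.
  by apply: (mulfI (lt0r_neq0 b0)); rewrite mulr0; lra.
have z3 : (t j)%:R - 1 - #|Q|%:R = 0 :> R.
  by apply: (mulIf (lt0r_neq0 yj)); rewrite mul0r; lra.
split.
  have /eqP PE : P == S.
    by rewrite eqEcard PS /= -(ler_nat R) -/s; lra.
  by move=> i; rewrite -{1}PE inE => /andP[].
have /eqP QE : j |: Q == [set i | connect d j i].
  by rewrite eqEcard QT /= -(ler_nat R) tE cQ -natr1; lra.
move=> i ji ij; have : i \in [set i | connect d j i] by rewrite inE.
by rewrite -QE !inE (negbTE ij) /= => /andP[].
Qed.

Hypothesis test : alpha * (n%:R - 1) + (1 - alpha) * (s - 1)
  + (1 - alpha) ^+ 2 * s * mu <= l.

Lemma cut_col j : col j <= l * y j.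
Proof.
have [jS|jS] := boolP (j \in S); last by have [] := cut_col_out j jS.
rewrite [y j]/y jS mulr1; apply: le_trans (cut_col_in j jS) (le_trans _ test).
rewrite lerD2l ler_pM2l ?mulr_gt0 ?exprn_gt0//.
by have [] := cut_sum.
Qed.

Lemma cut_eigenvalue_le a : eigenvalue (Aalpha alpha e) a -> a <= l.
Proof.
apply: (eigenvalue_le_test _ _ _ y) => [i j|i|j].
- by apply: Aalpha_ge0; case/andP: alpha01 => -> /ltW.
- exact: cut_test_gt0.
- exact: cut_col.
Qed.

Lemma cut_eigenvalue_eq a : connected_graph e ->
  eigenvalue (Aalpha alpha e) a -> l <= a ->
  [/\ ncomp_del e S = c,
      forall v, v \notin S -> #|connect (del_rel e S) v| = 1%N \/ #|connect (del_rel e S) v| = m,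
      forall u v, u \in S -> v \notin S -> e u v &
      forall u v, v \notin S -> connect (del_rel e S) v u -> u != v -> e u v].
Proof.
move=> conn ea la.
have ceq : forall j, col j = l * y j.
  apply: (eigenvalue_eq_test _ _ _ y l _ _ _ a) => // [i j|i|j|i j].
  - by apply: Aalpha_ge0; case/andP: alpha01 => -> /ltW.
  - exact: cut_test_gt0.
  - exact: cut_col.
  - apply: connect_sub (conn i j) => u v uv; apply: connect1.
    by apply: Aalpha_gt0 => //; rewrite e_sym.
(* Tightness at a single vertex of [S] already forces the sum up to its maximum [mu]. *)
have [j jS] := card_gt0P S0.
have [fm feq] := cut_sum.
have : \sum_(v in ~: S) (C - (t v)%:R)^-1 = mu.
  apply/eqP; rewrite eq_le fm /=.
  have bs : 0 < (1 - alpha) ^+ 2 * s by rewrite mulr_gt0 ?exprn_gt0.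
  rewrite -(ler_pM2l bs).
  by have := cut_col_in j jS; rewrite ceq [y j]/y jS mulr1; move: test; lra.
case/feq => -> tv; split => // [u v uS vS|u v vS].
  by have [_ /(_ (ceq v)) [-> //]] := cut_col_out v vS.
by have [_ /(_ (ceq v)) [_]] := cut_col_out v vS; apply.
Qed.

End VertexCut.

(** * Cones over a clique and isolated vertices *)

(** A label-free form of the extremal graph: [z] is the apex, [U] the clique, and all other vertices
    are pendant at [z]. *)
Definition clique_cone {n : nat} (e : rel 'I_n) (z : 'I_n) (U : {set 'I_n}) : Prop :=
  z \notin U /\
  forall x y, e x y = (x != y) && [|| x == z, y == z | (x \in U) && (y \in U)].

(** The partition into [z], [U] and the [p] pendant vertices is equitable. The eigenvector is
    constant on its cells, with values that solve the equations at [U] and at the pendant vertices;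
    the equation at [z] is then the assumed one. *)
Lemma clique_cone_eigenvalue (R : realType) (n : nat) (e : rel 'I_n) (alpha l : R)
  (z : 'I_n) (U : {set 'I_n}) (p : nat) :
  clique_cone e z U -> (#|U| + p).+1 = n ->
  l + 1 - alpha != 1 -> l + 1 - alpha != #|U|%:R ->
  alpha * (n%:R - 1) + (1 - alpha) ^+ 2 *
    (p%:R / (l + 1 - alpha - 1) + #|U|%:R / (l + 1 - alpha - #|U|%:R)) = l ->
  eigenvalue (Aalpha alpha e) l.
Proof.
case=> zU eE nE C1 Cm lE.
set C := l + 1 - alpha in C1 Cm lE.
have C1' : C - 1 != 0 by rewrite subr_eq0.
have Cm' : C - #|U|%:R != 0 by rewrite subr_eq0.
pose y i : R := if i == z then 1 else
  if i \in U then (1 - alpha) / (C - #|U|%:R) else (1 - alpha) / (C - 1).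
pose V := ~: (z |: U).
have cV : #|V| = p.
  by have := cardsC (z |: U); rewrite cardsU1 zU card_ord -/V -[RHS]nE => -[/addnI].
apply/eigenvalueP; exists (\row_i y i); last first.
  apply/negP => /eqP/rowP/(_ z); rewrite !mxE /y eqxx.
  by move/eqP; rewrite oner_eq0.
apply/rowP => j; rewrite !mxE.
under eq_bigr => i _ do rewrite [(\row_ _ _) _ _]mxE.
rewrite Aalpha_col card_deg.
have yU i : i \in U -> y i = (1 - alpha) / (C - #|U|%:R).
  by rewrite /y => iU; rewrite iU; case: eqP iU zU => // -> ->.
have yV i : i \in V -> y i = (1 - alpha) / (C - 1).
  by rewrite !inE negb_or /y => /andP[/negbTE -> /negbTE ->].
have [jz|jz] := eqVneq j z.
  have -> : #|[pred x | e j x]| = (#|U| + p)%N.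
    have := cardC (pred1 z); rewrite card1 card_ord -[RHS]nE => -[<-].
    by apply: eq_card => x; rewrite !inE eE jz eqxx andbT eq_sym.
  have -> : \sum_(i | e i j) y i = \sum_(i in U) y i + \sum_(i in V) y i.
    rewrite -bigU /=; last first.
      by rewrite -setI_eq0; apply/eqP/setP => x; rewrite !inE; case: (x \in U); rewrite ?andbF ?orbT.
    apply: eq_bigl => i; rewrite !inE eE jz eqxx orbT andbT.
    by case: eqP => [->|_]; rewrite ?(negbTE zU)//= orbN.
  rewrite (eq_bigr _ yU) (eq_bigr _ yV) !sumr_const cV jz /y eqxx !mulr1.
  apply: (etrans _ lE); rewrite (_ : n%:R = (#|U| + p).+1%:R); last by rewrite nE.
  rewrite -[((_ + _).+1)%:R]natr1 natrD -[(_ / _) *+ #|U|]mulr_natl -[(_ / _) *+ p]mulr_natl; field.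
  by rewrite C1' Cm'.
have [jU|jU] := boolP (j \in U).
  have -> : #|[pred x | e j x]| = #|U|.
    transitivity #|z |: (U :\ j)|; last first.
      by rewrite cardsU1 !inE (negbTE zU) andbF [in RHS](cardsD1 j U) jU.
    apply: eq_card => x; rewrite !inE eE (negbTE jz) jU /= eq_sym.
    by case: eqP => [->|]//; rewrite (negbTE jz).
  have -> : \sum_(i | e i j) y i = 1 + (#|U|%:R - 1) * ((1 - alpha) / (C - #|U|%:R)).
    rewrite (bigD1 z) /=; last by rewrite eE eqxx eq_sym jz.
    rewrite {1}/y eqxx; congr (_ + _).
    rewrite (eq_big (mem (U :\ j)) (fun=> (1 - alpha) / (C - #|U|%:R))).
    - rewrite sumr_const -[LHS]mulr_natl (cardsD1 j U) jU add1n -natr1; congr (_ * _).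
      by rewrite addrK.
    - move=> x; rewrite !inE eE jU (negbTE jz) andbT /=.
      case: (eqVneq x z) => [->|_]; rewrite ?(negbTE zU) ?andbF//=.
      by rewrite andbT.
    - move=> x /andP[]; rewrite eE (negbTE jz) jU andbT /= => /andP[_].
      by case: eqP => //= _ xU _; rewrite yU.
  rewrite yU// /C; field; exact: Cm'.
have -> : #|[pred x | e j x]| = 1%N.
  rewrite -(card1 z); apply: eq_card => x; rewrite !inE eE (negbTE jz) (negbTE jU) /=.
  by rewrite orbF; case: (eqVneq x z) => [->|_]; rewrite ?andbF ?jz.
have -> : \sum_(i | e i j) y i = 1.
  rewrite (eq_bigl (pred1 z)); first by rewrite big_pred1_eq /y eqxx.
  move=> x; rewrite /= eE (negbTE jz) (negbTE jU) /= andbF orbF.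
  by case: (eqVneq x z) => [->|_]; rewrite ?andbF// eq_sym jz.
rewrite yV ?inE ?negb_or ?jz// /C; field; exact: C1'.
Qed.

(** Listing [z], then [U], then the other vertices, the position in the list is the isomorphism. *)
Lemma clique_cone_isomorphic (n k : nat) (e : rel 'I_n) (z : 'I_n) (U : {set 'I_n}) :
  clique_cone e z U -> #|U| = (n - k - 2)%N -> isomorphic e (extremal_graph n k).
Proof.
case=> zU eE cU.
pose L1 := z :: enum U; pose L := L1 ++ enum (~: (z |: U)).
have inL x : x \in L.
  by rewrite mem_cat inE !mem_enum !inE; case: eqP => //= _; rewrite orbN.
have sL : size L = n.
  rewrite size_cat /= -!cardE -[RHS]card_ord -(cardsC (z |: U)).
  by rewrite cardsU1 zU.
have iL x : (index x L < n)%N by rewrite -[X in (_ < X)%N]sL index_mem.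
(* The initial segment [L1] has [n - k - 2] clique vertices plus [z], hence the non-strict
   inequality. *)
have indU x : (index x L <= n - k - 2)%N = (x \in L1).
  rewrite index_cat; case: ifPn => xL.
    by rewrite -ltnS -cU cardE -/(size L1) index_mem.
  by apply/negbTE; rewrite -ltnNge /= -cardE cU; lia.
have ind0 x : (index x L == 0)%N = (x == z).
  by rewrite /L /L1 /index /= [in RHS]eq_sym; case: (z == x).
have indI x y : index x L = index y L -> x = y.
  by move=> xy; rewrite -(nth_index z (inL x)) xy nth_index.
exists (fun x => Ordinal (iL x)); split.
  by apply: injF_bij => x y /(congr1 val)/indI.
move=> x y; rewrite /extremal_graph -val_eqE [val (Ordinal (iL x))]/(index x L)
  [val (Ordinal (iL y))]/(index y L) !indU !ind0 eE.
have -> : (index x L == index y L) = (x == y).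
  by apply/eqP/eqP => [/indI|->].
rewrite !inE !mem_enum.
by case: (x == z); case: (y == z).
Qed.

Lemma extremal_clique_cone (n k : nat) : (k + 2 < n)%N ->
  exists z U, clique_cone (extremal_graph n k) z U /\ #|U| = (n - k - 2)%N.
Proof.
move=> kn; have n0 : (0 < n)%N by lia.
have mn : (n - k - 2 < n)%N by lia.
pose U := [set x : 'I_n | (0 < x <= n - k - 2)%N].
exists (Ordinal n0), U; split; first split.
- by rewrite inE.
- move=> x y; rewrite /extremal_graph !inE -![_ == Ordinal n0]val_eqE /=.
  by case: (nat_of_ord x) => [|a]; case: (nat_of_ord y) => [|b].
(* The value of [f i] is [i.+1], since [ltn_ord i] unfolds to [i.+1 <= n - k - 2]. *)
pose f (i : 'I_(n - k - 2)) : 'I_n := Ordinal (leq_ltn_trans (ltn_ord i) mn).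
rewrite -[RHS]card_ord -(card_imset (f := f)); last first.
  by move=> i j /(congr1 val) /= [] /val_inj.
apply: eq_card => x; rewrite inE; apply/idP/imsetP => [/andP[x0 xm]|[i _ ->]].
  have xm' : (x.-1 < n - k - 2)%N by lia.
  by exists (Ordinal xm') => //; apply/val_inj; rewrite /= prednK.
by rewrite /= ltn_ord.
Qed.

(** Summing the reciprocals of the component orders gives [n - 1 + |U| (1 / m - 1) = k + 2], whence
    [|U| = m]: there is just one component of order [m]. The bound [k + 3 < n] gives [m > 1], which
    separates the two possible orders. *)
Lemma tight_cut_clique_cone (R : realFieldType) (n k : nat) (e : rel 'I_n) (z : 'I_n) :
  simple_graph e -> (k + 3 < n)%N ->
  let d := del_rel e [set z] in
  ncomp_del e [set z] = (k + 2)%N ->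
  (forall v, v != z -> #|connect d v| = 1%N \/ #|connect d v| = (n - k - 2)%N) ->
  (forall v, v != z -> e z v) ->
  (forall u v, v != z -> connect d v u -> u != v -> e u v) ->
  exists U, clique_cone e z U /\ #|U| = (n - k - 2)%N.
Proof.
move=> esimp kn d cE tv ez ed.
have [e_sym e_irr] := esimp.
set m := (n - k - 2)%N in tv *.
have m2 : (1 < m)%N by rewrite /m; lia.
have cd : connect_sym d by apply: del_rel_connect_sym.
have clS : closed d (~: [set z]) by apply: del_rel_closed.
pose U := [set v | (v != z) && (#|connect d v| == m)].
have cz : #|~: [set z]| = n.-1 by rewrite cardsC1 card_ord.
have cU : #|U| = m.
  have := sum_inv_card_component R _ d (~: [set z]) cd clS.
  rewrite -/(ncomp_del e [set z]) cE.
  rewrite (eq_bigr (fun v => 1 + (if v \in U then m%:R^-1 - 1 else 0))); last first.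
    move=> v; rewrite !inE => vz; rewrite vz /=.
    by case: (tv v vz) => ->; [rewrite (ltn_eqF m2) invr1 addr0|rewrite eqxx addrC subrK].
  rewrite big_split /= sumr_const cz -big_mkcondr /=.
  rewrite (eq_bigl (mem U)); last by move=> v; rewrite !inE; case: (v == z).
  rewrite sumr_const -[_ *+ #|U|]mulr_natl => H.
  have nE : n.-1%:R = m%:R - 1 + (k + 2)%:R :> R.
    have : (n.-1 + 1 = m + (k + 2))%N by rewrite /m; lia.
    by move=> /(congr1 (fun x => x%:R : R)); rewrite !natrD; lra.
  have m0 : m%:R != 0 :> R by rewrite pnatr_eq0; lia.
  have m1 : m%:R - 1 != 0 :> R by rewrite subr_eq0 pnatr_eq1; lia.
  apply/eqP; rewrite -(eqr_nat R); apply/eqP/(mulIf m1).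
  have {H} : (n.-1%:R + #|U|%:R * (m%:R^-1 - 1)) * m%:R = (k + 2)%:R * m%:R :> R.
    by rewrite H.
  rewrite nE mulrDl -mulrA mulrBl mulVf// mul1r; lra.
exists U; split => //; split; first by rewrite inE eqxx.
have t_gt0 v : (0 < #|connect d v|)%N by apply/card_gt0P; exists v; exact: connect0.
have [v0 v0U] : exists v, v \in U by apply/card_gt0P; rewrite cU; lia.
have v0z : v0 != z by move: v0U; rewrite inE => /andP[].
have tcon u v : connect d u v -> #|connect d u| = #|connect d v|.
  by move=> uv; apply: eq_card => w; rewrite !inE (same_connect cd uv).
have conz u v : connect d u v -> u != z -> v != z.
  by move=> uv; have := closed_connect clS uv; rewrite !inE => ->.
(* The component of [v0] lies in [U] and has as many elements as [U]. *)
have UE : [set w | connect d v0 w] = U.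
  apply/eqP; rewrite eqEcard; apply/andP; split.
    apply/fintype.subsetP => w; rewrite !inE => v0w.
    by rewrite (conz _ _ v0w v0z) -(tcon _ _ v0w); move: v0U; rewrite inE => /andP[].
  have -> : #|[set w | connect d v0 w]| = #|connect d v0|.
    by apply: eq_card => w; rewrite !inE.
  by move: v0U; rewrite inE cU => /andP[_ /eqP ->].
have UC v : (v \in U) = connect d v0 v by rewrite -UE inE.
move=> x y; have [->|xy] := eqVneq x y; first exact/negbTE/e_irr.
have [xz|xz] := eqVneq x z; first by rewrite xz ez // -xz eq_sym.
have [yz|yz] /= := eqVneq y z; first by rewrite yz e_sym ez.
apply/idP/andP => [exy|[xU yU]].
  have dxy : connect d x y by apply: connect1; rewrite /d /del_rel !inE xz yz.
  have tx : #|connect d x| = m.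
    case: (tv x xz) => // t1; have : (1 < #|connect d x|)%N.
      rewrite (cardD1 x) (cardD1 y) !inE.
      by rewrite /in_mem /= connect0 (eq_sym y x) xy dxy.
    by rewrite t1.
  by rewrite !inE xz yz -(tcon _ _ dxy) tx eqxx.
apply: ed => //; rewrite UC in xU; rewrite UC in yU.
by apply: connect_trans xU; rewrite cd.
Qed.

(** * Numerical estimates *)

(** This is what remains of [large_cut_bound] once [s] in the growing term is [(n - 2) / (k + 1)]
    and [(k + 1) / b] is replaced by its upper bound. *)
Lemma large_cut_bound_at_max (R : realFieldType) (k n : R) : 2 <= k -> 2 * k + 9 <= n ->
  (n - 2) * (k * n - k + 1) / ((k + 1) * ((2 * k + 1) * n - 2 * k ^+ 2 - 6 * k - 2))
  <= n - (n - 1) / (k + 1) - 2 * (2 * k + 1) * (n - k - 3) / (n - 1).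
Proof.
move=> hk hn.
(* In [a] and [b] all coefficients of the polynomial are nonnegative. *)
pose a := k - 2; pose b := n - 2 * k - 9.
have [a0 b0] : 0 <= a /\ 0 <= b by rewrite /a /b; split; lra.
have -> : k = a + 2 by rewrite /a; ring.
have -> : n = b + 2 * a + 13 by rewrite /b /a; ring.
have D0 : 0 < (2 * (a + 2) + 1) * (b + 2 * a + 13) - 2 * (a + 2) ^+ 2 - 6 * (a + 2) - 2.
  have -> : (2 * (a + 2) + 1) * (b + 2 * a + 13) - 2 * (a + 2) ^+ 2 - 6 * (a + 2) - 2
    = 2 * a ^+ 2 + 22 * a + 2 * (a * b) + 5 * b + 43 by ring.
  have := mulr_ge0 a0 b0; have := exprn_ge0 2 a0; lra.
set D := _ - 2 in D0 *.
have k1 : 0 < a + 2 + 1 by lra.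
have n1 : 0 < b + 2 * a + 13 - 1 by lra.
rewrite ler_pdivrMr ?mulr_gt0// -subr_ge0.
have -> : (b + 2 * a + 13 - (b + 2 * a + 13 - 1) / (a + 2 + 1)
   - 2 * (2 * (a + 2) + 1) * (b + 2 * a + 13 - (a + 2) - 3) / (b + 2 * a + 13 - 1)) * ((a + 2 + 1) * D)
   - (b + 2 * a + 13 - 2) * ((a + 2) * (b + 2 * a + 13) - (a + 2) + 1)
  = (36 * a ^+ 3 + 18 * (a ^+ 3 * b) + 384 * a ^+ 2 + 244 * (a ^+ 2 * b) + 2 * (a ^+ 3 * b ^+ 2)
    + 42 * (a ^+ 2 * b ^+ 2) + 822 * a + 671 * (a * b) + 137 * (a * b ^+ 2) + 312 + 484 * b
    + 120 * b ^+ 2 + 2 * (a ^+ 2 * b ^+ 3) + 8 * (a * b ^+ 3) + 8 * b ^+ 3) / (b + 2 * a + 13 - 1).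
  by rewrite /D; field; rewrite !gt_eqF//; lra.
by rewrite divr_ge0 ?(ltW n1)// !addr_ge0// ?mulr_ge0// ?exprn_ge0.
Qed.

(** With [b = 1 - alpha], [c = k s + 2] and [l = n - k - 2], this is the test inequality on [S],
    rearranged and divided by [b]. *)
Lemma large_cut_bound (R : realFieldType) (k n s b : R) :
  2 <= k -> 2 * k + 9 <= n -> 2 <= s -> (k + 1) * s + 2 <= n ->
  0 < b -> b <= 2^-1 -> (n - 1) * (k + 1) <= b * (2 * (2 * k + 1) * (n - k - 3)) ->
  b * s * ((n - (k + 1) * s - 1) / (k * (s - 1) + b * s)
    + (k * s + 1) / (n - k - 2 - s + b * s)) + (k + 1) / b <= n - s.
Proof.
move=> hk hn hs hns b0 hb hN.
have bs : b * s <= s - 1.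
  by have := ler_wpM2r (_ : 0 <= s) hb; lra.
have bs0 : 0 < b * s by rewrite mulr_gt0//; lra.
have ks0 : 0 < k * (s - 1) by rewrite mulr_gt0//; lra.
have ks1 : k * 2 <= k * s by rewrite ler_pM2l; lra.
have m0 : 0 < n - (k + 1) * s - 1 by lra.
have A0 : 0 < n - k - 2 - s by nra.
have E1 : b * s / (k * (s - 1) + b * s) <= (k + 1)^-1.
  rewrite ler_pdivrMr ?addr_gt0// ler_pdivlMl; last by lra.
  have := ler_wpM2l (_ : 0 <= k) bs; rewrite mulrDl => /(_ ltac:(lra)); lra.
(* The left side increases with [b]; the right side is its value at [b = 1/2]. *)
have E2 : b * s / (n - k - 2 - s + b * s) <= s / (2 * (n - k - 2) - s).
  rewrite ler_pdivrMr; last by lra.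
  rewrite [_ / _ * _]mulrAC ler_pdivlMr; last by lra.
  have : 0 <= s * (n - k - 2 - s) * (1 - 2 * b) by rewrite !mulr_ge0//; lra.
  nra.
have E3 : (k + 1) / b <= 2 * (2 * k + 1) * (n - k - 3) / (n - 1).
  by rewrite ler_pdivrMr// [_ / (n - 1) * _]mulrAC ler_pdivlMr; lra.
have k1 : 0 < k + 1 by lra.
have sle : s <= (n - 2) / (k + 1) by rewrite ler_pdivlMr// mulrC; lra.
have D0 : 0 < (2 * k + 1) * n - 2 * k ^+ 2 - 6 * k - 2.
  have -> : (2 * k + 1) * n - 2 * k ^+ 2 - 6 * k - 2 = 2 * (k - 2) ^+ 2
    + 22 * (k - 2) + 2 * ((k - 2) * (n - 2 * k - 9)) + 5 * (n - 2 * k - 9) + 43 by ring.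
  have a0 : 0 <= k - 2 by lra.
  have b1 : 0 <= n - 2 * k - 9 by lra.
  have := mulr_ge0 a0 b1; have := exprn_ge0 2 a0; lra.
(* The remaining [s]-dependent term is increasing, so [s] is replaced by its
   largest possible value [T]. *)
pose T := (n - 2) / (k + 1).
have TE : T * (k + 1) = n - 2 by rewrite /T divfK// gt_eqF.
have E4 : s * (k * s + 1) / (2 * (n - k - 2) - s) <=
  (n - 2) * (k * n - k + 1) / ((k + 1) * ((2 * k + 1) * n - 2 * k ^+ 2 - 6 * k - 2)).
  have -> : (n - 2) * (k * n - k + 1) / ((k + 1) * ((2 * k + 1) * n - 2 * k ^+ 2 - 6 * k - 2))
    = T * (k * T + 1) / (2 * (n - k - 2) - T).
    by rewrite /T; field; rewrite !gt_eqF//; lra.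
  have T0 : 2 * (n - k - 2) - T > 0 by nra.
  apply: ler_pM; rewrite ?invr_ge0 ?mulr_ge0//; try lra.
  - by apply: ler_pM; try lra; rewrite ?lerD2r ?ler_pM2l//; lra.
  - by rewrite lef_pV2 ?posrE//; rewrite -/T in sle; lra.
have := large_cut_bound_at_max _ _ _ hk hn.
have F1 : b * s * ((n - (k + 1) * s - 1) / (k * (s - 1) + b * s))
   <= (n - (k + 1) * s - 1) * (k + 1)^-1.
  by rewrite mulrCA ler_pM2l.
have F2 : b * s * ((k * s + 1) / (n - k - 2 - s + b * s))
   <= s * (k * s + 1) / (2 * (n - k - 2) - s).
  by rewrite mulrCA -mulrA [X in _ <= X]mulrCA ler_pM2l//; lra.
have F3 : (n - (k + 1) * s - 1) * (k + 1)^-1 = (n - 1) / (k + 1) - s.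
  by field; rewrite gt_eqF.
rewrite mulrDr; lra.
Qed.

(** Clearing denominators yields a cubic that is negative at [m] and nonnegative at [m + p], so the
    intermediate value theorem applies. *)
Lemma cone_root_exists (R : rcfType) (alpha m p : R) :
  0 <= alpha < 1 -> 1 <= m -> 1 <= p -> exists2 l, m < l &
  alpha * (m + p) + (1 - alpha) ^+ 2 *
    (p / (l + 1 - alpha - 1) + m / (l + 1 - alpha - m)) = l.
Proof.
move=> /andP[a0 a1] m1 p1.
have [b [b0 b1 ->]] : exists b, [/\ 0 < b, b <= 1 & alpha = 1 - b].
  by exists (1 - alpha); split; lra.
pose P := ('X - ((1 - b) * (m + p))%:P) * ('X + (b - m)%:P) * ('X + (b - 1)%:P)
  - (b ^+ 2 * m)%:P * ('X + (b - 1)%:P) - (b ^+ 2 * p)%:P * ('X + (b - m)%:P).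
have PE x : P.[x] = (x - (1 - b) * (m + p)) * (x + (b - m)) * (x + (b - 1))
   - b ^+ 2 * m * (x + (b - 1)) - b ^+ 2 * p * (x + (b - m)).
  by rewrite /P !hornerE.
have Pm : P.[m] < 0.
  have -> : P.[m] = - (b * p * ((1 - b) * (m + b - 1) + b ^+ 2)) by rewrite PE; ring.
  rewrite oppr_lt0 !mulr_gt0//; first lra.
  by rewrite ltr_wpDl ?exprn_gt0// mulr_ge0//; lra.
have Pn : 0 <= P.[m + p].
  have -> : P.[m + p] = b * m * p * (m + p + b - 1) + b * p * (p + b) * (m + p - 1).
    by rewrite PE; ring.
  by rewrite addr_ge0// !mulr_ge0//; lra.
have [l /andP[ml _] /rootP] := poly_ivt (a := m) (b := m + p) ltac:(lra) (introT andP (conj (ltW Pm) Pn)).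
rewrite PE => lP.
have {ml} ml : m < l.
  by rewrite lt_neqAle ml andbT; apply: contraTneq Pm => ->; rewrite PE lP ltxx.
exists l => //.
have h1 : l + b - 1 != 0 by rewrite gt_eqF//; lra.
have h2 : l + b - m != 0 by rewrite gt_eqF//; lra.
have -> : l + 1 - (1 - b) - 1 = l + b - 1 by ring.
have -> : l + 1 - (1 - b) - m = l + b - m by ring.
apply/eqP; rewrite -subr_eq0; apply/eqP.
have -> : (1 - b) * (m + p) + (1 - (1 - b)) ^+ 2 * (p / (l + b - 1) + m / (l + b - m)) - l
  = - ((l - (1 - b) * (m + p)) * (l + (b - m)) * (l + (b - 1))
   - b ^+ 2 * m * (l + (b - 1)) - b ^+ 2 * p * (l + (b - m))) / ((l + b - 1) * (l + b - m)).
  by field; rewrite h1 h2.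
by rewrite lP oppr0 mul0r.
Qed.

(** Here [k] is [1 / tau]. After multiplication by [k ^ 2], the bound on [alpha] says that the
    denominator is positive, and the bound on [n] is the conclusion solved for [n]. *)
Lemma order_bound (R : realFieldType) (alpha k n : R) : 2 <= k ->
  alpha < (3 + k^-1) / (4 + 2 * k^-1) ->
  ((5 - 6 * alpha) * k^-1 ^+ 2 + (13 - 14 * alpha) * k^-1 + 4 * (1 - alpha)) /
    ((1 - 2 * alpha) * k^-1 ^+ 2 + (3 - 4 * alpha) * k^-1) <= n ->
  (n - 1) * (k + 1) <= (1 - alpha) * (2 * (2 * k + 1) * (n - k - 3)).
Proof.
move=> k2.
have k0 : k != 0 by rewrite gt_eqF//; lra.
have -> : (3 + k^-1) / (4 + 2 * k^-1) = (3 * k + 1) / (4 * k + 2).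
  by field; rewrite k0 /= !gt_eqF//; lra.
rewrite ltr_pdivlMr; last by lra.
move=> ak.
have D0 : 0 < (1 - 2 * alpha) + (3 - 4 * alpha) * k by lra.
have -> : ((5 - 6 * alpha) * k^-1 ^+ 2 + (13 - 14 * alpha) * k^-1 + 4 * (1 - alpha)) /
    ((1 - 2 * alpha) * k^-1 ^+ 2 + (3 - 4 * alpha) * k^-1) =
   ((5 - 6 * alpha) + (13 - 14 * alpha) * k + 4 * (1 - alpha) * k ^+ 2) /
    ((1 - 2 * alpha) + (3 - 4 * alpha) * k).
  by field; rewrite k0 !gt_eqF.
by rewrite ler_pdivrMr// => H; lra.
Qed.

Lemma order_ge (R : realFieldType) (k : nat) (n : nat) : (2 <= k)%N ->
  2 * (k%:R^-1) ^+ 2 + 5 * k%:R^-1 + 2 * k%:R + 8 <= n%:R :> R -> (2 * k + 9 <= n)%N.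
Proof.
move=> k2 H; have k0 : 0 < k%:R^-1 :> R by rewrite invr_gt0 ltr0n; lia.
have : (2 * k + 8)%:R < n%:R :> R.
  rewrite natrD natrM; have := exprn_ge0 2 (ltW k0); lra.
by rewrite ltr_nat; lia.
Qed.

(** * Comparison with the extremal graph *)

(** The root of the quotient equation is an eigenvalue of the extremal graph, hence a lower bound
    for its spectral radius. *)
Lemma rho_extremal_gt (R : realType) (n k : nat) (alpha : R) :
  0 <= alpha < 1 -> (k + 3 < n)%N -> exists l, [/\ (n - k - 2)%:R < l,
  alpha * (n%:R - 1) + (1 - alpha) ^+ 2 *
    ((k + 1)%:R / (l + 1 - alpha - 1) + (n - k - 2)%:R / (l + 1 - alpha - (n - k - 2)%:R)) = l &
  l <= rho_alpha alpha (extremal_graph n k)].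
Proof.
move=> a01 kn; have [z [U [cone cU]]] := extremal_clique_cone n k ltac:(lia).
have m1 : 1 <= (n - k - 2)%:R :> R by rewrite ler1n; lia.
have p1 : 1 <= (k + 1)%:R :> R by rewrite ler1n; lia.
have [l ml lE] := cone_root_exists _ _ _ _ a01 m1 p1.
have nE : (n - k - 2)%:R + (k + 1)%:R = n%:R - 1 :> R.
  have : (n - k - 2 + (k + 1) + 1 = n)%N by lia.
  by move=> /(congr1 (fun x => x%:R : R)); rewrite !natrD; lra.
rewrite nE in lE; exists l; split => //.
have [a0 a1] := andP a01.
apply: ub_le_sup.
  by apply: has_ubound_eigenvalue => i j; apply: Aalpha_ge0; rewrite a0 ltW.
apply: (clique_cone_eigenvalue _ _ _ _ _ z U (k + 1)) => //; rewrite ?cU//.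
- by lia.
- by rewrite gt_eqF//; lra.
- by rewrite gt_eqF//; lra.
Qed.

(** The test is run at [n - k - 2], strictly below [l], so a weak bound on the eigenvalues
    suffices. *)
Lemma rho_lt_of_large_cut (R : realType) (n k : nat) (e : rel 'I_n) (alpha l : R)
  (S : {set 'I_n}) : simple_graph e -> (2 <= k)%N -> 2^-1 <= alpha < 1 ->
  (2 * k + 9 <= n)%N ->
  (n%:R - 1) * (k%:R + 1) <= (1 - alpha) * (2 * (2 * k%:R + 1) * (n%:R - k%:R - 3)) ->
  (1 < #|S|)%N -> (k * #|S| + 2 <= ncomp_del e S)%N -> (k * #|S| + 2 + #|S| <= n)%N ->
  (n - k - 2)%:R < l -> rho_alpha alpha e < l.
Proof.
move=> esimp k2 /andP[a2 a1] kn hN s2 cS nS ll.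
apply: sup_eigenvalue_lt => [|a ea]; first exact: le_lt_trans ll.
apply: le_lt_trans ll.
(* The largest possible component order [n - s - (c - 1)], for [c = k s + 2]. *)
pose m := (n - (k * #|S| + 1) - #|S|)%N.
have mS : (m + (k * #|S| + 2) + #|S| = n.+1)%N.
  by rewrite /m; move: nS; move: (k * #|S|)%N #|S| => u v; clear; lia.
have k2r : 2 <= k%:R :> R by rewrite ler_nat.
have knr : 2 * k%:R + 9 <= n%:R :> R by rewrite -natrM -natrD ler_nat.
have s2r : 2 <= #|S|%:R :> R by rewrite ler_nat.
have nSr : (k%:R + 1) * #|S|%:R + 2 <= n%:R :> R.
  by rewrite mulrDl mul1r -natrM -!natrD ler_nat addnAC.
have nkE : (n - k - 2)%:R = n%:R - k%:R - 2 :> R by rewrite -subnDA natrB ?natrD ?opprD ?addrA// addn2; lia.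
have mE : m%:R = n%:R - (k%:R + 1) * #|S|%:R - 1 :> R.
  by move/(congr1 (fun x => x%:R : R)): mS; rewrite -natr1 !natrD natrM; lra.
have b0 : 0 < 1 - alpha by lra.
have b2 : 1 - alpha <= 2^-1 by lra.
have := large_cut_bound _ _ _ _ _ k2r knr s2r nSr b0 b2 hN.
set s : R := #|S|%:R in s2r nSr mE *.
move=> H; have bs : 0 < (1 - alpha) * s by rewrite mulr_gt0//; lra.
have ks : 0 <= k%:R * (s - 1) by rewrite mulr_ge0//; lra.
have CE : (n - k - 2)%:R + 1 - alpha * s - m%:R = k%:R * (s - 1) + (1 - alpha) * s.
  by rewrite nkE mE; ring.
apply: (cut_eigenvalue_le R n e alpha _ S (k * #|S| + 2) m) => //.
- by rewrite a1 (le_trans _ a2)// invr_ge0.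
- exact: ltnW.
- by rewrite addn2.
- by rewrite -subr_gt0 -/s CE; lra.
rewrite -/s CE.
have -> : (n - k - 2)%:R + 1 - alpha * s - 1 = n%:R - k%:R - 2 - s + (1 - alpha) * s.
  by rewrite nkE; ring.
have -> : (k * #|S| + 2)%:R - 1 = k%:R * s + 1 :> R by rewrite natrD natrM -/s; ring.
rewrite mE nkE.
have := ler_wpM2l (ltW b0) H.
rewrite mulrDr [(1 - alpha) * (_ / (1 - alpha))]mulrC divfK ?gt_eqF//.
set A := _ / _; set B := _ / _ => H'.
have -> : (1 - alpha) ^+ 2 * s * (B + A) = (1 - alpha) * ((1 - alpha) * s * (A + B)) by ring.
lra.
Qed.

(** For [s = 1] and [c = k + 2] the test inequality is the quotient equation itself. An eigenvalue
    at least [l] would make everything tight and [e] extremal. *)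
Lemma rho_lt_of_vertex_cut (R : realType) (n k : nat) (e : rel 'I_n) (alpha l : R)
  (z : 'I_n) : simple_graph e -> connected_graph e -> 0 <= alpha < 1 -> (k + 3 < n)%N ->
  ~ isomorphic e (extremal_graph n k) ->
  (k + 2 <= ncomp_del e [set z])%N ->
  (n - k - 2)%:R < l ->
  alpha * (n%:R - 1) + (1 - alpha) ^+ 2 *
    ((k + 1)%:R / (l + 1 - alpha - 1) + (n - k - 2)%:R / (l + 1 - alpha - (n - k - 2)%:R)) = l ->
  rho_alpha alpha e < l.
Proof.
move=> esimp conn a01 kn niso cS ml lE.
have [a0 a1] := andP a01.
apply: sup_eigenvalue_lt => [|a ea]; first exact: le_lt_trans ml.
rewrite ltNge; apply/negP => la; apply: niso.
have S0 : (0 < #|[set z]|)%N by rewrite cards1.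
have c2 : (1 < k + 2)%N by rewrite addn2.
have mS : (n - k - 2 + (k + 2) + #|[set z]| = n.+1)%N by rewrite cards1; lia.
have mC : (n - k - 2)%:R < l + 1 - alpha * #|[set z]|%:R by rewrite cards1 mulr1; lra.
have [] := cut_eigenvalue_eq R n e alpha l [set z] (k + 2) (n - k - 2)
  esimp a01 S0 c2 cS mS mC _ a conn ea la.
  rewrite cards1 subrr mulr0 addr0 !mulr1 -[X in _ <= X]lE.
  by rewrite (_ : (k + 2)%:R - 1 = (k + 1)%:R :> R)// !natrD; ring.
move=> cE tv ez ed.
have [|||U [cone cU]] := tight_cut_clique_cone R n k e z esimp kn cE.
- by move=> v vz; apply: tv; rewrite inE.
- by move=> v vz; apply: ez; rewrite !inE.
- by move=> u v vz; apply: ed; rewrite inE.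
exact: clique_cone_isomorphic cone cU.
Qed.

Theorem theorem1p2 (R : realType) (n : nat) (e : rel 'I_n) (tau alpha : R) (k : nat) :
  simple_graph e -> connected_graph e ->
  0 < tau -> (2 <= k)%N -> tau^-1 = k%:R ->
  2^-1 <= alpha -> alpha < (3 + tau) / (4 + 2 * tau) ->
  2 * tau ^+ 2 + 5 * tau + 2 / tau + 8 <= n%:R ->
  ((5 - 6 * alpha) * tau ^+ 2 + (13 - 14 * alpha) * tau + 4 * (1 - alpha)) /
    ((1 - 2 * alpha) * tau ^+ 2 + (3 - 4 * alpha) * tau) <= n%:R ->
  rho_alpha alpha (extremal_graph n k) <= rho_alpha alpha e ->
  ~ isomorphic e (extremal_graph n k) ->
  tough tau e.
Proof.
move=> esimp conn tau0 k2 tauk a2 atau n1 n2 rho niso S _ c1.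
rewrite leNgt; apply/negP => Slt.
have tauE : tau = k%:R^-1 by rewrite -tauk invrK.
rewrite tauk in n1; rewrite tauE in tau0 atau n1 n2 Slt.
have k0 : 0 < k%:R :> R by rewrite -invr_gt0.
have k2r : 2 <= k%:R :> R by rewrite ler_nat.
have a1 : alpha < 1.
  apply: lt_le_trans atau _; move: k2r tau0; clear => k2r tau0.
  by rewrite ler_pdivrMr ?mul1r; lra.
have n9 := order_ge _ _ _ k2 n1.
have kn : (k + 3 < n)%N by move: n9; clear; lia.
have hN := order_bound _ _ _ _ k2r atau n2.
(* Failure of toughness reads [k s < c - 1]; between integers this is [k s + 2 <= c]. *)
have cS : (k * #|S| + 2 <= ncomp_del e S)%N.
  have : (k * #|S| < (ncomp_del e S).-1)%N.
    by rewrite -(ltr_nat R) natrM -ltr_pdivlMl.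
  by move: (k * #|S|)%N (ncomp_del e S) => u v; clear; lia.
have S0 := connected_cut_gt0 _ _ _ conn c1.
(* Distinct components have distinct roots, all outside [S]. *)
have nS : (k * #|S| + 2 + #|S| <= n)%N.
  rewrite -[X in (_ <= X)%N]card_ord -(cardsC S) addnC leq_add2l (leq_trans cS)//.
  by apply: subset_leq_card; apply/fintype.subsetP => x /andP[].
have a01 : 0 <= alpha < 1 by rewrite a1 (le_trans _ a2)// invr_ge0.
have [l [ml lE lrho]] := rho_extremal_gt _ n k _ a01 kn.
(* This contradicts [l <= rho_alpha alpha (extremal_graph n k) <= rho_alpha alpha e]. *)
suff : rho_alpha alpha e < l by apply/negP; rewrite -leNgt; exact: le_trans rho.
have [S1|S1] := eqVneq #|S| 1%N; last first.
  apply: (rho_lt_of_large_cut _ _ k _ _ _ S) => //; last by rewrite ltn_neqAle eq_sym S1.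
  by rewrite a2.
have /cards1P[z Sz] := introT eqP S1.
rewrite Sz cards1 muln1 in cS.
by apply: (rho_lt_of_vertex_cut _ _ k _ _ _ z).
Qed.
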